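(* Let $G$ be a group and let $R$ be a $G$-graded commutative ring. The following statements are equivalent: (1) $R$ is a Gelfand graded ring; (2) any two disjoint closed subsets $F,F'$ of $G\mathrm{Spec}(R)$ can be separated by a regular function, i.e. there exists $r\in R$ such that $r(P)=0$ for all $P\in F$ and $r(P)=1$ for all $P\in F'$.
   Context: $G$ is a group with identity $e$. A commutative ring $R$ with unit is $G$-graded if $R=\bigoplus_{g\in G}R_g$ with additive subgroups $R_g$ satisfying $R_gR_{g'}\subseteq R_{gg'}$; $h(R)=\bigcup_{g\in G}R_g$ is the set of homogeneous elements. An ideal $I$ is graded if $I=\bigoplus_{g\in G}(I\cap R_g)$. A homogeneous prime ideal is a graded ideal $P\neq R$ such that for all $r,s\in h(R)$, $rs\in P$ implies $r\in P$ or $s\in P$; $G\mathrm{Spec}(R)$ is the set of these. A graded maximal ideal is a graded ideal that is maximal among proper graded ideals. The Zariski topology on $G\mathrm{Spec}(R)$ has as closed sets the sets $V_G(I)=\{P\in G\mathrm{Spec}(R) : I\subseteq P\}$, $I$ a graded ideal. $R$ is called a Gelfand ($G$-)graded ring if every homogeneous prime ideal of $R$ is contained in a unique graded maximal ideal of $R$. For $P\in G\mathrm{Spec}(R)$, $R_P$ denotes the ring of fractions of $R$ with respect to the multiplicatively closed set $h(R)\setminus P$, and for $r\in R$, $r(P)$ denotes the canonical image of $r$ in $R_P$; thus $r(P)=0$ if and only if $ra=0$ for some $a\in h(R)\setminus P$. *)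

(* Defs.v *)
From HB Require Import structures.
From mathcomp Require Import all_boot all_order all_algebra.
From mathcomp Require Import generic_quotient finmap.
From mathcomp Require Import mathcomp_extra boolp classical_sets functions.
From mathcomp Require Import cardinality fsbigop topology ring.

Set Implicit Arguments.
Unset Strict Implicit.
Unset Printing Implicit Defensive.

Import GRing.Theory.
Local Open Scope classical_set_scope.
Local Open Scope quotient_scope.
Local Open Scope ring_scope.

Section Localization.
Variables (R : comPzRingType) (S : mulrClosed R).

Record fraction := Fraction { num : R; den : R; den_in : den \in S }.

HB.instance Definition _ := gen_eqMixin fraction.
HB.instance Definition _ := gen_choiceMixin fraction.

Implicit Types x y z : fraction.

Definition frac_equiv x y : bool :=
  `[< exists2 u, u \in S & u * (num x * den y - num y * den x) = 0 >].

Fact frac_equiv_refl : reflexive frac_equiv.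
Proof. by move=> x; apply/asboolP; exists 1; rewrite ?rpred1 // mul1r subrr. Qed.

Fact frac_equiv_sym : symmetric frac_equiv.
Proof.
suff imp x y : frac_equiv x y -> frac_equiv y x.
  by move=> x y; apply/idP/idP => /imp.
move=> /asboolP[u Su uxy]; apply/asboolP; exists u => //.
by rewrite -opprB mulrN uxy oppr0.
Qed.

Fact frac_equiv_trans : transitive frac_equiv.
Proof.
move=> y x z /asboolP[u Su uxy] /asboolP[v Sv vyz]; apply/asboolP.
exists (u * v * den y); first by rewrite !rpredM ?den_in.
transitivity (v * den z * (u * (num x * den y - num y * den x)) +
              u * den x * (v * (num y * den z - num z * den y))); first by ring.
by rewrite uxy vyz !mulr0 addr0.
Qed.

Canonical frac_equiv_equiv :=
  EquivRel frac_equiv frac_equiv_refl frac_equiv_sym frac_equiv_trans.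

Definition localization := {eq_quot frac_equiv}.

HB.instance Definition _ : EqQuotient _ frac_equiv localization :=
  EqQuotient.on localization.
HB.instance Definition _ := Choice.on localization.

Lemma fracP x y :
  reflect (exists2 u, u \in S & u * (num x * den y - num y * den x) = 0)
          (x == y %[mod localization]).
Proof. by rewrite eqmodE; exact: asboolP. Qed.

Lemma frac_repr x : exists2 u, u \in S &
  u * (num (repr (\pi_localization x)) * den x
       - num x * den (repr (\pi_localization x))) = 0.
Proof. by apply/fracP; rewrite reprK. Qed.

Definition frac_of r : fraction := @Fraction r 1 (rpred1 S).
Definition frac_add x y : fraction :=
  @Fraction (num x * den y + num y * den x) (den x * den y)
            (rpredM (den_in x) (den_in y)).
Definition frac_opp x : fraction := @Fraction (- num x) (den x) (den_in x).
Definition frac_mul x y : fraction :=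
  @Fraction (num x * num y) (den x * den y)
            (rpredM (den_in x) (den_in y)).

Definition loc_of := lift_embed localization frac_of.
Canonical loc_of_pi_morph := PiEmbed loc_of.

Definition loc_add := lift_op2 localization frac_add.
Definition loc_opp := lift_op1 localization frac_opp.
Definition loc_mul := lift_op2 localization frac_mul.

Fact pi_loc_add : {morph \pi : x y / frac_add x y >-> loc_add x y}.
Proof.
move=> x y; unlock loc_add; apply/eqP/fracP => /=.
have [u Su] := frac_repr x; have [v Sv] := frac_repr y.
move: (repr _) (repr _) => x' y' vy ux; exists (u * v); first exact: rpredM.
transitivity (- (v * den y * den y' * (u * (num x' * den x - num x * den x'))
  + u * den x * den x' * (v * (num y' * den y - num y * den y'))));
  first by ring.
by rewrite ux vy !mulr0 addr0 oppr0.
Qed.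
Canonical pi_loc_add_morph := PiMorph2 pi_loc_add.

Fact pi_loc_opp : {morph \pi : x / frac_opp x >-> loc_opp x}.
Proof.
move=> x; unlock loc_opp; apply/eqP/fracP => /=.
have [u Su ux] := frac_repr x; exists u => //.
by rewrite -[RHS]ux; ring.
Qed.
Canonical pi_loc_opp_morph := PiMorph1 pi_loc_opp.

Fact pi_loc_mul : {morph \pi : x y / frac_mul x y >-> loc_mul x y}.
Proof.
move=> x y; unlock loc_mul; apply/eqP/fracP => /=.
have [u Su] := frac_repr x; have [v Sv] := frac_repr y.
move: (repr _) (repr _) => x' y' vy ux; exists (u * v); first exact: rpredM.
transitivity (- (v * num y * den y' * (u * (num x' * den x - num x * den x'))
  + u * num x' * den x * (v * (num y' * den y - num y * den y'))));
  first by ring.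
by rewrite ux vy !mulr0 addr0 oppr0.
Qed.
Canonical pi_loc_mul_morph := PiMorph2 pi_loc_mul.

Let frac_eq x y :
  num x * den y = num y * den x -> \pi_localization x = \pi_localization y.
Proof.
move=> xy; apply/eqP/fracP; exists 1; first exact: rpred1.
by rewrite xy subrr mulr0.
Qed.

Fact loc_addA : associative loc_add.
Proof.
by elim/quotW=> x; elim/quotW=> y; elim/quotW=> z; rewrite !piE;
  apply: frac_eq => /=; ring.
Qed.

Fact loc_addC : commutative loc_add.
Proof.
by elim/quotW=> x; elim/quotW=> y; rewrite !piE; apply: frac_eq => /=; ring.
Qed.

Fact loc_add0 : left_id (loc_of 0) loc_add.
Proof. by elim/quotW=> x; rewrite !piE; apply: frac_eq => /=; ring. Qed.

Fact loc_addN : left_inverse (loc_of 0) loc_opp loc_add.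
Proof. by elim/quotW=> x; rewrite !piE; apply: frac_eq => /=; ring. Qed.

HB.instance Definition _ :=
  GRing.isZmodule.Build localization loc_addA loc_addC loc_add0 loc_addN.

Fact loc_mulA : associative loc_mul.
Proof.
by elim/quotW=> x; elim/quotW=> y; elim/quotW=> z; rewrite !piE;
  apply: frac_eq => /=; ring.
Qed.

Fact loc_mulC : commutative loc_mul.
Proof.
by elim/quotW=> x; elim/quotW=> y; rewrite !piE; apply: frac_eq => /=; ring.
Qed.

Fact loc_mul1 : left_id (loc_of 1) loc_mul.
Proof. by elim/quotW=> x; rewrite !piE; apply: frac_eq => /=; ring. Qed.

Fact loc_mulDl : left_distributive loc_mul loc_add.
Proof.
by elim/quotW=> x; elim/quotW=> y; elim/quotW=> z; rewrite !piE;
  apply: frac_eq => /=; ring.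
Qed.

HB.instance Definition _ := GRing.Zmodule_isComPzRing.Build localization
  loc_mulA loc_mulC loc_mul1 loc_mulDl.

Fact loc_of_is_zmod_morphism : zmod_morphism loc_of.
Proof.
move=> r s; rewrite -[RHS]/(loc_add (loc_of r) (loc_opp (loc_of s))) !piE.
by apply: frac_eq => /=; ring.
Qed.

Fact loc_of_is_monoid_morphism : monoid_morphism loc_of.
Proof.
split=> // r s; rewrite -[RHS]/(loc_mul (loc_of r) (loc_of s)) !piE.
by apply: frac_eq => /=; ring.
Qed.

HB.instance Definition _ :=
  GRing.isZmodMorphism.Build R localization loc_of loc_of_is_zmod_morphism.
HB.instance Definition _ :=
  GRing.isMonoidMorphism.Build R localization loc_of loc_of_is_monoid_morphism.

Lemma loc_of_eq0 r : loc_of r = 0 <-> exists2 u, u \in S & r * u = 0.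
Proof.
rewrite -[0]/(loc_of 0) !piE; split=> [/eqP/fracP[u Su /= ur]|[u Su ur]].
  by exists u => //; rewrite -[RHS]ur; ring.
by apply/eqP/fracP; exists u; rewrite //= -[RHS]ur; ring.
Qed.

End Localization.

Section DirectSum.
Variables (I : choiceType) (V : zmodType).
Implicit Types (M : set V) (N : I -> set V) (f : I -> V).

Definition finsupp_family N : set (I -> V) :=
  [set f | finite_set [set i | f i != 0] /\ forall i, N i (f i)].

(* The support condition in [finsupp_family] matters: [\sum_(i \in setT) f i]
   is 0 by convention when f has infinite support. *)
Definition internal_direct_sum M N : Prop :=
  set_bij (finsupp_family N) M (fun f => \sum_(i \in setT) f i).

End DirectSum.

Record grading (G : groupType) (R : comPzRingType) := Grading {
  component :> G -> set R;
  component_zmod_closed : forall g, GRing.zmod_closed [in component g];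
  component_direct_sum : internal_direct_sum setT component;
  component_mul : forall g g' x y,
    component g x -> component g' y -> component (g * g')%g (x * y)
}.

Section GradedIdeals.
Variables (G : groupType) (R : comPzRingType) (A : grading G R).
Implicit Types I J M P : set R.

Definition homogeneous : set R := \bigcup_g A g.

Definition is_ideal I : Prop :=
  [/\ I 0, forall x y, I x -> I y -> I (x + y) & forall a x, I x -> I (a * x)].

Definition graded_ideal I : Prop :=
  is_ideal I /\ internal_direct_sum I (fun g => I `&` A g).

Definition homogeneous_prime P : Prop :=
  [/\ graded_ideal P, P <> setT &
      forall r s, homogeneous r -> homogeneous s -> P (r * s) -> P r \/ P s].

Definition graded_maximal M : Prop :=
  [/\ graded_ideal M, M <> setT &
      forall J, graded_ideal J -> J <> setT -> M `<=` J -> J = M].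

Record GSpec := MkGSpec {
  GSpec_ideal :> set R;
  GSpec_prime : homogeneous_prime GSpec_ideal
}.

HB.instance Definition _ := gen_eqMixin GSpec.
HB.instance Definition _ := gen_choiceMixin GSpec.

Definition zariski_V I : set GSpec := [set P | I `<=` P].

Definition gelfand_graded : Prop :=
  forall P : GSpec, exists! M : set R, graded_maximal M /\ P `<=` M.

Local Notation fsum f := (\sum_(g \in setT) f g).
Local Notation fam := (finsupp_family A).

Lemma component0 g : A g 0.
Proof. by have [+ _] := component_zmod_closed A g; rewrite inE. Qed.

Lemma componentB g x y : A g x -> A g y -> A g (x - y).
Proof.
have [_ h] := component_zmod_closed A g.
by move=> Ax Ay; have := h x y; rewrite !inE; apply.
Qed.

Lemma decomposition x : exists2 f, fam f & fsum f = x.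
Proof. by have [_ _ h] := component_direct_sum A; exact: (h x I). Qed.

Lemma decomposition_inj f f' : fam f -> fam f' -> fsum f = fsum f' -> f = f'.
Proof.
have [_ h _] := component_direct_sum A.
by move=> ff ff'; apply: h; rewrite inE.
Qed.

Lemma is_ideal_fsum I (f : G -> R) :
  is_ideal I -> (forall g, I (f g)) -> I (fsum f).
Proof. by move=> [I0 ID _] If; elim/big_ind: _ => // *; exact: ID. Qed.

Lemma graded_idealE I : is_ideal I ->
  internal_direct_sum I (fun g => I `&` A g) <->
  forall f, fam f -> I (fsum f) -> forall g, I (f g).
Proof.
move=> idI; split=> [[_ _ surj] f famf If g|stab].
  have [f' [f'fin f'I] eqff'] := surj _ If.
  suff <- : f' = f by have [] := f'I g.
  by apply: decomposition_inj => //; split=> // k; have [] := f'I k.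
split=> [f [_ fI] | f f' | x Ix].
- by apply: is_ideal_fsum => // g; have [] := fI g.
- rewrite !inE => -[ffin fI] [f'fin f'I].
  by apply: decomposition_inj; split=> // g; [have [] := fI g|have [] := f'I g].
- have [f famf fx] := decomposition x; exists f => //.
  have If : I (fsum f) by rewrite fx.
  by split=> [|g]; [case: famf|split; [exact: stab|case: famf]].
Qed.

Lemma graded_ideal_setT : graded_ideal setT.
Proof.
have idT : is_ideal setT by split.
by split=> //; apply/graded_idealE.
Qed.

Lemma graded_ideal_bigcap (D : set (set R)) :
  (forall I, D I -> graded_ideal I) -> graded_ideal (\bigcap_(I in D) I).
Proof.
move=> gD; have idD : is_ideal (\bigcap_(I in D) I).
  split=> [I DI|x y xD yD I DI|a x xD I DI];
    have [[I0 ID IM] _] := gD _ DI => //.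
  - by apply: ID; [exact: xD|exact: yD].
  - by apply: IM; exact: xD.
split=> //; apply/(graded_idealE idD) => f famf fD g I DI.
have [idI dsI] := gD _ DI; move/(graded_idealE idI): dsI; apply=> //.
exact: fD.
Qed.

Lemma graded_idealI I J : graded_ideal I -> graded_ideal J ->
  graded_ideal (I `&` J).
Proof.
move=> gI gJ; have -> : I `&` J = \bigcap_(K in [set I; J]) K.
  by rewrite bigcap_setU !bigcap_set1.
by apply: graded_ideal_bigcap => K [->|->].
Qed.

Lemma graded_ideal_homogeneous I P x : graded_ideal I -> is_ideal P ->
  I x -> ~ P x -> exists2 y, homogeneous y & I y /\ ~ P y.
Proof.
move=> [idI dsI] idP Ix nPx; have [f famf fx] := decomposition x.
have [g nPf] : exists g, ~ P (f g).
  by apply/existsNP => Pf; apply: nPx; rewrite -fx; exact: is_ideal_fsum.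
exists (f g); first by exists g => //; case: famf.
split=> //; move/(graded_idealE idI): dsI; apply=> //.
by rewrite fx.
Qed.

Lemma component1 : A 1%g 1.
Proof.
have [f famf f1] := decomposition 1.
have finf a : finite_set [set g | a * f g != 0].
  apply: sub_finite_set famf.1 => g /=.
  by apply: contra_neq => ->; rewrite mulr0.
have mulf a : a = \sum_(g \in setT) (a * f g).
  rewrite -[LHS]mulr1 -f1.
  apply: (@full_fsbig_distrr _ _ (@GRing.mul R) (@GRing.add R)).
  apply: sub_finite_set famf.1 => g [_ /=] /eqP //.
have hom1 x : homogeneous x -> x = x * f 1%g.
  move=> [h _ Ax]; pose u k := x * f (h^-1 * k)%g.
  pose v k := if k == h then x else 0.
  suff : v = u by move=> /(congr1 (@^~ h)); rewrite /u /v eqxx mulVg.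
  have hK : cancel (fun k => h^-1 * k)%g (fun k => h * k)%g by exact: mulVKg.
  have hK' : cancel (fun k => h * k)%g (fun k => h^-1 * k)%g by exact: mulKg.
  apply: decomposition_inj.
  - split=> [|k].
      apply: (@sub_finite_set _ _ [set h]) => // k /=; rewrite /v.
      by case: (eqVneq k h) => //; rewrite eqxx.
    by rewrite /v; case: (eqVneq k h) => [->|_] //; exact: component0.
  - split=> [|k].
      apply: (@sub_finite_set _ _ [set (h * g)%g | g in [set g | x * f g != 0]]).
        by move=> k /= uk; exists (h^-1 * k)%g; rewrite ?hK.
      exact: finite_image.
    by rewrite /u -{1}(hK k); apply: component_mul => //; case: famf.
  - transitivity x.
      rewrite (fsbigTE [fset h]%fset) ?big_seq_fset1 /v ?eqxx // => k.
      by rewrite inE => /negPf ->.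
    rewrite [LHS]mulf (@reindex_fsbigT _ _ _ _ _ (fun k => h^-1 * k)%g) //.
    by exists (fun k => h * k)%g.
suff <- : f 1%g = 1 by case: famf.
rewrite [LHS]mulf -[RHS]f1.
by apply: eq_fsbigr => g _; rewrite mulrC -hom1 //; exists g => //; case: famf.
Qed.

Lemma homogeneous1 : homogeneous 1.
Proof. by exists 1%g => //; exact: component1. Qed.

Lemma homogeneousM x y : homogeneous x -> homogeneous y -> homogeneous (x * y).
Proof.
by move=> [g _ Ax] [h _ Ay]; exists (g * h)%g => //; exact: component_mul.
Qed.

Lemma homogeneous_prime1 P : homogeneous_prime P -> ~ P 1.
Proof.
move=> [[[_ _ PM] _] PT _] P1; apply: PT; rewrite -subTset => x _.
by rewrite -[x]mulr1; exact: PM.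
Qed.

Definition zariski_open (U : set GSpec) : Prop :=
  exists2 I, graded_ideal I & ~` U = zariski_V I.

Fact zariski_openT : zariski_open setT.
Proof.
exists setT; first exact: graded_ideal_setT.
rewrite setCT; apply/esym; rewrite -subset0 => P /= TP.
exact: (homogeneous_prime1 (GSpec_prime P)) (TP 1 I).
Qed.

Fact zariski_openI : setI_closed zariski_open.
Proof.
move=> U U' [I gI UI] [J gJ U'J].
exists (I `&` J); first exact: graded_idealI.
rewrite setCI UI U'J; apply/seteqP; split=> P /=.
  by case=> sP x [Ix Jx]; exact: sP.
move=> IJP; apply: contrapT => /not_orP[].
move=> /existsNP[x /not_implyP[Ix nPx]] /existsNP[y /not_implyP[Jy nPy]].
have [gP _ primeP] := GSpec_prime P.
have [x' hx' [Ix' nPx']] := graded_ideal_homogeneous gI gP.1 Ix nPx.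
have [y' hy' [Jy' nPy']] := graded_ideal_homogeneous gJ gP.1 Jy nPy.
have [[_ _ IM] _] := gI; have [[_ _ JM] _] := gJ.
suff /(primeP _ _ hx' hy')[] : GSpec_ideal P (x' * y') by [].
by apply: IJP; split; [rewrite mulrC; exact: IM|exact: JM].
Qed.

Fact zariski_open_bigU (T : Type) (U : T -> set GSpec) :
  (forall i, zariski_open (U i)) -> zariski_open (\bigcup_i U i).
Proof.
move=> /(_ _)/cid2-/all_sig2[I gI UI].
pose D := [set J | graded_ideal J /\ forall i, I i `<=` J].
exists (\bigcap_(J in D) J); first by apply: graded_ideal_bigcap => J [].
rewrite setC_bigcup; apply/seteqP; split=> P /=.
  move=> UP x; apply; split=> [|i]; first by have [] := GSpec_prime P.
  by have : (~` U i) P := UP i Logic.I; rewrite UI.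
move=> DP i _; suff : zariski_V (I i) P by rewrite -UI.
by move=> x Ix; apply: DP => J [_ /(_ i x Ix)].
Qed.

HB.instance Definition _ :=
  isOpenTopological.Build GSpec zariski_openT zariski_openI zariski_open_bigU.

Lemma zariski_closedE (F : set GSpec) :
  closed F <-> exists2 I, graded_ideal I & F = zariski_V I.
Proof. by rewrite -openC; split=> -[I gI FI]; exists I; rewrite // -FI setCK. Qed.

Definition denominators (P : GSpec) : {pred R} :=
  fun a => `[< homogeneous a /\ ~ GSpec_ideal P a >].

Fact denominators_mulr_closed (P : GSpec) : GRing.mulr_closed (denominators P).
Proof.
have hP := GSpec_prime P; split=> [|a b /asboolP[ha nPa] /asboolP[hb nPb]].
  by apply/asboolP; split; [exact: homogeneous1|exact: homogeneous_prime1].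
have [_ _ primeP] := hP; apply/asboolP; split; first exact: homogeneousM.
by case/(primeP _ _ ha hb).
Qed.

HB.instance Definition _ (P : GSpec) :=
  GRing.isMulClosed.Build R (denominators P) (denominators_mulr_closed P).

Definition graded_localization (P : GSpec) := localization (denominators P).

Definition germ (P : GSpec) (r : R) : graded_localization P :=
  loc_of (denominators P) r.

HB.instance Definition _ (P : GSpec) :=
  GRing.ComPzRing.on (graded_localization P).
HB.instance Definition _ (P : GSpec) :=
  GRing.RMorphism.copy (germ P) (loc_of (denominators P)).

Lemma germ_eq0 (P : GSpec) r : germ P r = 0 <->
  exists2 a, homogeneous a /\ ~ GSpec_ideal P a & r * a = 0.
Proof.
apply: iff_trans (loc_of_eq0 _ _) _.
by split=> -[a aP ra]; exists a => //; apply/asboolP.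
Qed.

End GradedIdeals.

(* Main.v *)
Require Import Defs.
From mathcomp Require Import all_boot all_order all_algebra.
From mathcomp Require Import boolp classical_sets cardinality fsbigop topology.
From mathcomp Require Import ring.

Import GRing.Theory.
Local Open Scope classical_set_scope.
Local Open Scope ring_scope.

(** For (2) => (1), a regular function separating two graded maximal ideals
    [M != M'] yields homogeneous [a \notin M] and [b \notin M'] with [a b = 0],
    so no homogeneous prime is contained in both.  Conversely, over a Gelfand
    ring such [a] and [b] always exist: otherwise some homogeneous prime avoids
    all the products [a b].  Let [N(F)] be the graded ideal of the elements whose
    germs vanish on [F].  If [N(V(I)) + N(V(J))] were proper, it would lie in a
    graded maximal ideal [M], and [M] misses one of [I] and [J], say [J].  The
    elements killed by some homogeneous [b \notin M], together with [J], lie in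
    no graded maximal ideal, so [1 = x + j] with [b x = 0] and [j \in J].  Then
    [x] lies in no prime containing [J], so [b \in N(V(J))], contradicting
    [b \notin M].  Hence [1 = r + r'] with [r \in N(V(I))], [r' \in N(V(J))]. *)

Section GradedIdealOperations.
Set Implicit Arguments.
Unset Strict Implicit.
Variables (G : groupType) (R : comPzRingType) (A : grading G R).
Implicit Types (I J M Q S : set R) (f : G -> R).

(** * Finitely supported homogeneous families: sums and shifts *)

Lemma componentD g x y : A g x -> A g y -> A g (x + y).
Proof.
move=> Ax Ay; rewrite -[y]opprK; apply: componentB => //.
by rewrite -[- y]add0r; apply: componentB => //; exact: component0.
Qed.

Lemma finsupp_familyD f f' :
  finsupp_family A f -> finsupp_family A f' -> finsupp_family A (f \+ f').
Proof.
move=> [ffin fA] [f'fin f'A]; split=> [|g]; last exact: componentD.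
apply: (sub_finite_set _ (_ : finite_set
  ([set g | f g != 0] `|` [set g | f' g != 0]))); last by rewrite finite_setU.
move=> g /= ffg; have [f0|] := eqVneq (f g) 0; last by left.
by right; move: ffg; rewrite f0 add0r.
Qed.

Lemma fsum_finsuppD f f' : finsupp_family A f -> finsupp_family A f' ->
  \sum_(g \in setT) (f g + f' g) =
  \sum_(g \in setT) f g + \sum_(g \in setT) f' g.
Proof.
move=> [ffin _] [f'fin _].
(* All three sums are restricted to one finite set carrying both supports, where they split
   termwise. *)
set D := [set g | f g != 0] `|` [set g | f' g != 0].
have finD : finite_set D by rewrite finite_setU.
have fD g : (setT `\` D) g -> f g = 0 /\ f' g = 0.
  by move=> [_ /not_orP[/negP/negPn/eqP-> /negP/negPn/eqP->]].
have DE (h : G -> R) : (forall g, (setT `\` D) g -> h g = 0) ->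
    \sum_(g \in setT) h g = \sum_(g \in D) h g.
  by move=> hD; apply/esym/fsbig_widen.
rewrite !DE ?fsbig_split // => g /fD[fg f'g] //.
by rewrite fg f'g addr0.
Qed.

(** This family is the homogeneous decomposition of [x * b] when [f] is that of [x]; as [G] may be
    noncommutative, the shift is on the right. *)
Lemma finsupp_family_shift f h b : finsupp_family A f -> A h b ->
  finsupp_family A (fun g => f (g * h^-1)%g * b).
Proof.
move=> [ffin fA] Ab; split=> [|g]; last first.
  by rewrite -{1}(mulgVK h g); exact: component_mul.
apply: (sub_finite_set _ (finite_image (fun g => g * h)%g ffin)) => g /= fgb.
exists (g * h^-1)%g; last by rewrite mulgVK.
by apply: contra_neq fgb => ->; rewrite mul0r.
Qed.

Lemma fsum_shift f h b : finsupp_family A f ->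
  \sum_(g \in setT) f (g * h^-1)%g * b = (\sum_(g \in setT) f g) * b.
Proof.
move=> [ffin _]; rewrite -(@reindex_fsbigT _ _ _ _ _ (fun g => g * h^-1)%g
  (fun g => f g * b)); last first.
  by exists (fun g => g * h)%g; [exact: mulgVK|exact: mulgK].
rewrite mulrC (@full_fsbig_distrr _ _ (@GRing.mul R) (@GRing.add R)).
  by apply: eq_fsbigr => g _; rewrite mulrC.
by apply: sub_finite_set ffin => g [_ /=] /eqP.
Qed.

(** * Constructions of graded ideals *)

Lemma graded_idealP I : is_ideal I ->
  (forall x, I x -> exists f, [/\ finsupp_family A f,
     \sum_(g \in setT) f g = x & forall g, I (f g)]) -> graded_ideal A I.
Proof.
move=> idI decI; split=> //; apply/graded_idealE => // f famf /decI.
(* Decompositions are unique, so the one with components in [I] is the given [f]. *)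
by move=> [f' [famf' /(decomposition_inj famf' famf) <-]].
Qed.

Lemma graded_ideal_decomposition I x : graded_ideal A I -> I x ->
  exists f, [/\ finsupp_family A f, \sum_(g \in setT) f g = x &
     forall g, I (f g)].
Proof.
move=> [idI /(graded_idealE A idI) dsI] Ix.
have [f famf fx] := decomposition A x; exists f; split=> // g.
by apply: dsI; rewrite ?fx.
Qed.

Definition ideal_sum I J : set R := [set x + y | x in I & y in J].

Lemma graded_ideal_sum I J :
  graded_ideal A I -> graded_ideal A J -> graded_ideal A (ideal_sum I J).
Proof.
move=> gI gJ; have [[I0 ID IM] _] := gI; have [[J0 JD JM] _] := gJ.
apply: graded_idealP; first split.
- by exists 0 => //; exists 0; rewrite ?addr0.
- move=> _ _ [x Ix [y Jy <-]] [x' Ix' [y' Jy' <-]].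
  by exists (x + x'); [exact: ID|exists (y + y'); [exact: JD|ring]].
- move=> a _ [x Ix [y Jy <-]].
  by exists (a * x); [exact: IM|exists (a * y); [exact: JM|ring]].
move=> _ [x Ix [y Jy <-]].
have [f [famf <- If]] := graded_ideal_decomposition gI Ix.
have [f' [famf' <- Jf']] := graded_ideal_decomposition gJ Jy.
exists (f \+ f'); split; [exact: finsupp_familyD|exact: fsum_finsuppD|].
by move=> g; exists (f g) => //; exists (f' g).
Qed.

Lemma ideal_sum_subl I J : is_ideal J -> I `<=` ideal_sum I J.
Proof. by move=> [J0 _ _] x Ix; exists x => //; exists 0; rewrite ?addr0. Qed.

Lemma ideal_sum_subr I J : is_ideal I -> J `<=` ideal_sum I J.
Proof. by move=> [I0 _ _] x Jx; exists 0 => //; exists x; rewrite ?add0r. Qed.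

Definition principal_ideal (r : R) : set R := [set a * r | a in setT].

Lemma graded_principal_ideal r :
  homogeneous A r -> graded_ideal A (principal_ideal r).
Proof.
move=> [h _ Ar]; apply: graded_idealP; first split.
- by exists 0; rewrite ?mul0r.
- by move=> _ _ [a _ <-] [b _ <-]; exists (a + b); rewrite ?mulrDl.
- by move=> a _ [b _ <-]; exists (a * b); rewrite ?mulrA.
move=> _ [a _ <-]; have [f famf <-] := decomposition A a.
exists (fun g => f (g * h^-1)%g * r); split; [|exact: fsum_shift|].
  exact: finsupp_family_shift.
by move=> g; exists (f (g * h^-1)%g).
Qed.

Lemma principal_ideal_id r : principal_ideal r r.
Proof. by exists 1; rewrite ?mul1r. Qed.

Definition annihilator (b : R) : set R := [set x | x * b = 0].

(** The products [f g * b] are the components of [x * b = 0] in the pairwise distinct degrees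
    [g * h], so each of them vanishes. *)
Lemma graded_annihilator b : homogeneous A b -> graded_ideal A (annihilator b).
Proof.
move=> [h _ Ab]; have idb : is_ideal (annihilator b).
  split=> [|x y xb yb|a x xb]; rewrite /annihilator /=.
  - by rewrite mul0r.
  - by rewrite mulrDl xb yb addr0.
  - by rewrite -mulrA xb mulr0.
split=> //; apply/graded_idealE => // f famf fb g.
have fam0 : finsupp_family A (fun=> 0).
  split=> [|k]; last exact: component0.
  apply: (@sub_finite_set _ _ set0) => // k /=.
  by rewrite eqxx.
have shift0 : (fun g => f (g * h^-1)%g * b) = (fun=> 0).
  apply: (decomposition_inj (finsupp_family_shift famf Ab) fam0).
  by rewrite fsum_shift // fb fsbig1.
by have := congr1 (@^~ (g * h)%g) shift0; rewrite /= mulgK.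
Qed.

Lemma graded_ideal_bigcup (D : set (set R)) : D !=set0 -> total_on D subset ->
  (forall I, D I -> graded_ideal A I) -> graded_ideal A (\bigcup_(I in D) I).
Proof.
move=> [I0 DI0] totD gD; have idD : is_ideal (\bigcup_(I in D) I).
  split=> [|x y [I DI Ix] [J DJ Jy]|a x [I DI Ix]].
  - by exists I0 => //; have [[]] := gD _ DI0.
  - have [IJ|JI] := totD _ _ DI DJ.
      by exists J => //; have [[_ JD _] _] := gD _ DJ; apply: JD => //; exact: IJ.
    by exists I => //; have [[_ ID _] _] := gD _ DI; apply: ID => //; exact: JI.
  - by exists I => //; have [[_ _ IM] _] := gD _ DI; exact: IM.
split=> //; apply/graded_idealE => // f famf [I DI If] g; exists I => //.
by have [idI /(graded_idealE A idI)] := gD _ DI; apply.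
Qed.

(** * Graded ideals maximal among those avoiding a set *)

Lemma maximal_graded_ideal_disjoint I S :
  graded_ideal A I -> I `&` S = set0 ->
  exists Q, [/\ graded_ideal A Q, I `<=` Q, Q `&` S = set0 &
    forall J, graded_ideal A J -> J `&` S = set0 -> Q `<=` J -> J = Q].
Proof.
move=> gI IS.
(* Zorn's lemma here also requires the union of the empty chain, which is the empty set; stating the
   property for [I] united with [X] makes that case hold. *)
pose Z := [set X | graded_ideal A (I `|` X) /\ (I `|` X) `&` S = set0].
have [F FZ totF|X [[gX XS] maxX]] := @Zorn_bigcup R Z.
  pose D := I |` [set I `|` X | X in F].
  have DE : I `|` \bigcup_(X in F) X = \bigcup_(J in D) J.
    apply/seteqP; split=> [x [Ix|[X FX Xx]]|x [_ [->|[X FX <-]]]].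
    - by exists I => //; left.
    - by exists (I `|` X); [right; exists X|right].
    - by left.
    - by move=> [Ix|Xx]; [left|right; exists X].
  have gD J : D J -> graded_ideal A J.
    by move=> [->|[X /FZ[gX _] <-]].
  split; rewrite DE.
    apply: graded_ideal_bigcup => //; first by exists I; left.
    move=> _ _ [->|[X FX <-]] [->|[Y FY <-]].
    - by left.
    - by left; exact: subsetUl.
    - by right; exact: subsetUl.
    - by have [XY|YX] := totF _ _ FX FY; [left|right]; exact: setUS.
  rewrite -subset0 => x [[J [->|[X /FZ[_ XS] <-]] Jx] Sx].
    by rewrite -IS.
  by rewrite -XS.
exists (I `|` X); split=> // J gJ JS XJ; apply: contrapT => JX.
have IJ : I `|` J = J by apply/setUidPr => x Ix; apply: XJ; left.
apply: (maxX J); last by rewrite /Z /= IJ.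
split=> [x Xx|JX']; first by apply: XJ; right.
by apply: JX; apply/seteqP; split=> // x /JX' Xx; right.
Qed.

(** If homogeneous [r] and [s] lie outside [Q], then [Q + (r)] and [Q + (s)] are graded and strictly
    larger, so both meet [S]. The product of the two elements found is in [S], and in [Q] as soon as
    [r * s] is. *)
Lemma maximal_disjoint_prime S Q : S 1 ->
  (forall x y, S x -> S y -> S (x * y)) ->
  graded_ideal A Q -> Q `&` S = set0 ->
  (forall J, graded_ideal A J -> J `&` S = set0 -> Q `<=` J -> J = Q) ->
  homogeneous_prime A Q.
Proof.
move=> S1 SM gQ QS maxQ; have [idQ _] := gQ; have [_ QD QM] := idQ.
split=> // [QT|r s hr hs Qrs].
  by have : (Q `&` S) 1; [rewrite QT|rewrite QS].
have meets t : homogeneous A t -> ~ Q t -> exists q a, Q q /\ S (q + a * t).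
  move=> ht nQt; set J := ideal_sum Q (principal_ideal t).
  have gJ : graded_ideal A J.
    by apply: graded_ideal_sum => //; exact: graded_principal_ideal.
  have [|/eqP/set0P] := pselect (J `&` S = set0).
    move/(maxQ J gJ) => JQ; case: nQt; rewrite -JQ.
      by apply: ideal_sum_subr => //; exact: principal_ideal_id.
    by apply: ideal_sum_subl; case: (graded_principal_ideal ht).
  by move=> [_ [[q Qq [_ [a _ <-] <-]] Sqa]]; exists q, a.
apply: contrapT => /not_orP[/(meets r hr)[q [a [Qq Sa]]]].
move=> /(meets s hs)[q' [a' [Qq' Sa']]].
suff : (Q `&` S) ((q + a * r) * (q' + a' * s)) by rewrite QS.
split; last exact: SM.
have -> : (q + a * r) * (q' + a' * s) =
    (q' + a' * s) * q + (a * r * q' + a * a' * (r * s)) by ring.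
by apply: (QD); [exact: QM|apply: QD; exact: QM].
Qed.

(** Recasts properness as avoiding a multiplicative set, so that graded maximal ideals become the
    case [S = {1}] of the two preceding lemmas. *)
Lemma proper_ideal_disjoint1 I :
  is_ideal I -> I <> setT <-> I `&` [set 1] = set0.
Proof.
move=> [_ _ IM]; split=> [IT|I1 IT].
  rewrite -subset0 => x [Ix x1]; apply: IT; rewrite -subTset => y _.
  by rewrite -[y]mulr1; apply: IM; rewrite -x1.
suff : (I `&` [set 1]) 1 by rewrite I1.
by rewrite IT.
Qed.

Lemma exists_graded_maximal I : graded_ideal A I -> I <> setT ->
  exists2 M, graded_maximal A M & I `<=` M.
Proof.
move=> gI IT.
have [|M [gM IM MT maxM]] := @maximal_graded_ideal_disjoint I [set 1] gI.
  by apply/proper_ideal_disjoint1 => //; case: gI.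
exists M => //; split=> //.
  by apply/proper_ideal_disjoint1 => //; case: gM.
move=> J gJ JT; apply: maxM => //.
by apply/proper_ideal_disjoint1 => //; case: gJ.
Qed.

Lemma graded_maximal_prime M : graded_maximal A M -> homogeneous_prime A M.
Proof.
move=> [gM MT maxM]; apply: (@maximal_disjoint_prime [set 1]) => //.
- by move=> x y -> ->; rewrite mulr1.
- by apply/proper_ideal_disjoint1 => //; case: gM.
- move=> J gJ J1 MJ; apply: maxM => //.
  by apply/proper_ideal_disjoint1 => //; case: gJ.
Qed.

(** * Vanishing of germs and separation in Gelfand rings *)

Definition germ_kernel (P : GSpec A) : set R := [set r | germ P r = 0].

(** A single homogeneous [b] outside [P] kills the element, and its graded annihilator then contains
    every component. *)
Lemma graded_germ_kernel P : graded_ideal A (germ_kernel P).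
Proof.
have idP : is_ideal (germ_kernel P).
  split=> [|x y Px Py|a x Px]; rewrite /germ_kernel /=.
  - exact: rmorph0.
  - by rewrite rmorphD /= Px Py addr0.
  - by rewrite rmorphM /= Px mulr0.
split=> //; apply/graded_idealE => // f famf /germ_eq0[b [hb Pb] fb] g.
apply/germ_eq0; exists b => //.
have [idb /(graded_idealE A idb)] := graded_annihilator hb.
exact.
Qed.

Lemma gelfand_separation M M' : gelfand_graded A ->
  graded_maximal A M -> graded_maximal A M' -> M <> M' ->
  exists a b,
    [/\ homogeneous A a /\ ~ M a, homogeneous A b /\ ~ M' b & a * b = 0].
Proof.
move=> gelf mM mM' MM'; apply: contrapT => noab.
have [[_ _ primeM] [_ _ primeM']] :=
  (graded_maximal_prime mM, graded_maximal_prime mM').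
have M1 := homogeneous_prime1 (graded_maximal_prime mM).
have M'1 := homogeneous_prime1 (graded_maximal_prime mM').
pose S := [set a * b | a in [set a | homogeneous A a /\ ~ M a]
                     & b in [set b | homogeneous A b /\ ~ M' b]].
have S1 : S 1.
  exists 1; first by split=> //; exact: homogeneous1.
  by exists 1; rewrite ?mulr1 //; split=> //; exact: homogeneous1.
have SM x y : S x -> S y -> S (x * y).
  move=> [a [ha Ma] [b [hb Mb] <-]] [a' [ha' Ma'] [b' [hb' Mb'] <-]].
  exists (a * a').
    by split; [exact: homogeneousM|case/(primeM _ _ ha ha')].
  exists (b * b'); last by ring.
  by split; [exact: homogeneousM|case/(primeM' _ _ hb hb')].
have g0 : graded_ideal A [set 0].
  have -> : [set 0] = annihilator 1.
    by apply/seteqP; split=> x; rewrite /annihilator /= mulr1.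
  exact/graded_annihilator/homogeneous1.
have [|Q [gQ _ QS maxQ]] := @maximal_graded_ideal_disjoint [set 0] S g0.
  rewrite -subset0 => _ [-> [a aM [b bM' ab]]].
  by apply: noab; exists a, b.
have pQ := maximal_disjoint_prime S1 SM gQ QS maxQ.
have [idQ _] := gQ.
have disjS x : Q x -> S x -> False.
  by move=> Qx Sx; have : (Q `&` S) x by []; rewrite QS.
(* A homogeneous [y] outside [M] would be [y * 1] in [S]; since [Q] is graded, testing homogeneous
   elements suffices. *)
have QM : Q `<=` M.
  move=> x Qx; apply: contrapT => Mx; have [[idM _] _ _] := mM.
  have [y hy [Qy My]] := graded_ideal_homogeneous gQ idM Qx Mx.
  apply: (disjS y) => //; exists y => //; exists 1; rewrite ?mulr1 //.
  by split=> //; exact: homogeneous1.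
have QM' : Q `<=` M'.
  move=> x Qx; apply: contrapT => Mx; have [[idM _] _ _] := mM'.
  have [y hy [Qy My]] := graded_ideal_homogeneous gQ idM Qx Mx.
  apply: (disjS y) => //; exists 1; first by split=> //; exact: homogeneous1.
  by exists y; rewrite ?mul1r.
have [N [_ uniN]] := gelf (MkGSpec pQ).
by apply: MM'; rewrite -(uniN M) // -(uniN M').
Qed.

Definition vanishing_ideal (F : set (GSpec A)) : set R :=
  [set r | forall P, F P -> germ P r = 0].

Lemma graded_vanishing_ideal F : graded_ideal A (vanishing_ideal F).
Proof.
have -> : vanishing_ideal F =
    \bigcap_(K in [set germ_kernel P | P in F]) K.
  apply/seteqP; split=> r Fr; first by move=> _ [P FP <-]; exact: Fr.
  by move=> P FP; apply: (Fr (germ_kernel P)); exists P.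
by apply: graded_ideal_bigcap => _ [P _ <-]; exact: graded_germ_kernel.
Qed.

Lemma gelfand_vanishing_not_sub J M : gelfand_graded A ->
  graded_ideal A J -> graded_maximal A M -> ~ J `<=` M ->
  ~ vanishing_ideal (zariski_V J) `<=` M.
Proof.
move=> gelf gJ mM JM VM; pose PM := MkGSpec (graded_maximal_prime mM).
have gK := graded_germ_kernel PM.
have KJT : ideal_sum (germ_kernel PM) J = setT.
  apply: contrapT => KJT.
  have [M' mM' KJM'] := exists_graded_maximal (graded_ideal_sum gK gJ) KJT.
  have M'M : M' <> M.
    by move=> eqM; apply: JM; rewrite -eqM => x Jx; apply/KJM'/ideal_sum_subr/Jx;
      case: gK.
  (* [b] lies outside [M] and kills [a], so [a] is in the germ kernel at [M], hence in [M']. *)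
  have [a [b [[ha M'a] bM ab]]] := gelfand_separation gelf mM' mM M'M.
  apply: M'a; apply/KJM'/ideal_sum_subl; first by case: gJ.
  by apply/germ_eq0; exists b.
have [x /germ_eq0[b [hb Mb] xb] [j Jj xj1]] :
  ideal_sum (germ_kernel PM) J 1 by rewrite KJT.
apply: Mb; apply: VM => P JP; apply/germ_eq0.
have [[idP _] _ _] := GSpec_prime P; have [_ PD _] := idP.
have Px : ~ GSpec_ideal P x.
  move=> Px; apply: (homogeneous_prime1 (GSpec_prime P)).
  by rewrite -xj1; apply: PD => //; exact: JP.
(* [x] need not be homogeneous, but one of its components outside [P] is, and it too is killed by
   [b]: this is the denominator needed. *)
have [y hy [yb Py]] :=
  graded_ideal_homogeneous (graded_annihilator hb) idP xb Px.
by exists y => //; rewrite mulrC.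
Qed.

End GradedIdealOperations.

Theorem theorem2p12 (G : groupType) (R : comPzRingType) (A : grading G R) :
  gelfand_graded A <->
  (forall F F' : set (GSpec A), closed F -> closed F' -> F `&` F' = set0 ->
     exists r : R, (forall P : GSpec A, F P -> germ P r = 0) /\
                   (forall P : GSpec A, F' P -> germ P r = 1)).
Proof.
split=> [gelf F F' /zariski_closedE[I gI ->] /zariski_closedE[J gJ ->] IJ0|sep P].
  have NT : ideal_sum (vanishing_ideal (@zariski_V _ _ A I))
                        (vanishing_ideal (@zariski_V _ _ A J)) = setT.
    set NI := vanishing_ideal _; set NJ := vanishing_ideal (zariski_V J).
    have gNI : graded_ideal A NI := graded_vanishing_ideal _.
    have gNJ : graded_ideal A NJ := graded_vanishing_ideal _.
    apply: contrapT => NT; have [M mM NM] :=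
      exists_graded_maximal (graded_ideal_sum gNI gNJ) NT.
    have [IM|IM] := pselect (I `<=` M); last first.
      apply: (gelfand_vanishing_not_sub gelf gI mM IM) => x NIx.
      by apply/NM/ideal_sum_subl/NIx; case: gNJ.
    apply: (gelfand_vanishing_not_sub gelf gJ mM); last first.
      by move=> x NJx; apply/NM/ideal_sum_subr/NJx; case: gNI.
    (* If [M] contained both [I] and [J], it would itself be a point of the two disjoint closed
       sets. *)
    move=> JM; pose PM := MkGSpec (graded_maximal_prime mM).
    suff : (@zariski_V _ _ A I `&` zariski_V J) PM by rewrite IJ0.
    by [].
  have [r Nr [r' Nr' rr'1]] : ideal_sum (vanishing_ideal (@zariski_V _ _ A I))
    (vanishing_ideal (@zariski_V _ _ A J)) 1 by rewrite NT.
  exists r; split=> // Q JQ.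
  by rewrite -(rmorph1 (germ Q)) -rr'1 rmorphD /= (Nr' Q JQ) addr0.
have [gP PT primeP] := GSpec_prime P.
have [M mM PM] := exists_graded_maximal gP PT.
exists M; split=> // M' [mM' PM']; apply: contrapT => MM'.
have closedM N : graded_maximal A N -> closed (@zariski_V _ _ A N).
  by move=> [gN _ _]; apply/zariski_closedE; exists N.
(* A homogeneous prime containing both [M] and [M'] is proper and graded, so by maximality it equals
   both; hence the closed sets are disjoint. *)
have [|r [r0 r1]] := sep _ _ (closedM M mM) (closedM M' mM').
  rewrite -subset0 => Q [MQ M'Q]; have [gQ QT _] := GSpec_prime Q.
  have [_ _ maxM] := mM; have [_ _ maxM'] := mM'.
  by apply: MM'; rewrite -(maxM Q) // -(maxM' Q).
have /germ_eq0[a [ha Ma] ra] :=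
  r0 (MkGSpec (graded_maximal_prime mM)) (@subset_refl _ M).
have : germ (MkGSpec (graded_maximal_prime mM')) (1 - r) = 0.
  by rewrite rmorphB rmorph1 /= r1 ?subrr //; exact: subset_refl.
move=> /germ_eq0[b [hb M'b] rb].
(* [r] is killed by [a] and [1 - r] by [b], so [a * b] kills their sum [1]. *)
have ab0 : a * b = 0.
  transitivity (b * (r * a) + a * ((1 - r) * b)); first by ring.
  by rewrite ra rb !mulr0 addr0.
have Pab : GSpec_ideal P (a * b) by rewrite ab0; case: gP => -[].
by case: (primeP _ _ ha hb Pab) => [/PM|/PM'].
Qed.
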